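(* Let $m>0$ and $\hbar>0$ be constants and let $\rho(x,t)>0$ be the probability density, in one space dimension, of the position $x(t)$ of a quantum particle of mass $m$ whose paths are the nonsmooth (fractal) paths described in the context. Put $\partial=\partial/\partial x$, let $U=\frac{\hbar}{m}\frac{\partial\sqrt{\rho}}{\sqrt{\rho}}$, and let $Q=-\frac{\hbar^2}{2m}\frac{\partial^2\sqrt{\rho}}{\sqrt{\rho}}$ be the quantum potential. Then $Q$ can be written in the form $$Q=-\frac{m}{2}U^2-\frac{\hbar}{2}\,\partial U .$$ Hence the quantum potential arises directly from the fractal nonsmooth nature of the quantum paths. Since $Q$ can be thought of as a quantization of a classical motion, the quantization corresponds exactly to the existence of nonsmooth paths. Consequently smooth paths imply no quantum mechanics.
   Context: The setting is the scale-relativity (Nottale) derivation of the Schrödinger equation. The position $x(t)$ follows continuous nonsmooth paths and is treated as a stochastic process with $dx=b_+\,dt+d\xi_+$ for $dt>0$ and $dx=b_-\,dt+d\xi_-$ for $dt<0$. Here $b_+$ and $b_-$ are the forward and backward mean velocities, that is, the limits as $\Delta t\to0_+$ of the averages $\langle (x(t+\Delta t)-x(t))/\Delta t\rangle$ and $\langle (x(t)-x(t-\Delta t))/\Delta t\rangle$. The term $\xi$ is a Wiener process whose increments are Gaussian with mean $0$, mutually independent, with $\langle d\xi_{\pm i}\,d\xi_{\pm j}\rangle=\pm2\mathcal{D}\,\delta_{ij}\,dt$ and diffusion coefficient $\mathcal{D}=\hbar/2m$; this encodes the fractal (Hausdorff) dimension 2 of the trajectories. With $V=\frac12(b_++b_-)$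 and $U=\frac12(b_+-b_-)$ one has $U=\mathcal{D}\,\partial\log\rho=\frac{\hbar}{m}\frac{\partial\sqrt{\rho}}{\sqrt{\rho}}$, so $U$ records the difference between forward and backward mean velocities. Replacing $d/dt$ in Newtonian mechanics by the complex operator $\partial_t-i\mathcal{D}\partial^2+\mathcal{V}\,\partial$, where $\mathcal{V}=V-iU$, leads to the Schrödinger equation $i\hbar\psi_t=-\frac{\hbar^2}{2m}\psi_{xx}+\mathfrak{U}\psi$, where $\mathfrak{U}$ is the potential energy. Writing $\psi=\sqrt{\rho}\,e^{iS/\hbar}$, the Schrödinger equation yields the classical Hamilton–Jacobi equation with the extra term $Q$, namely $S_t+\frac{(\partial S)^2}{2m}+\mathfrak{U}+Q=0$, together with the continuity equation for $\rho$; in this sense $Q$ is regarded as a quantization of the classical motion. The statements following the identity are interpretive conclusions of the proposition, not formally quantified assertions. *)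

(* Defs.v *)
From mathcomp Require Import all_boot all_order all_algebra.
From mathcomp Require Import all_classical all_reals all_analysis.
Set Implicit Arguments.
Unset Strict Implicit.
Unset Printing Implicit Defensive.
Import Order.TTheory GRing.Theory Num.Theory.
Import numFieldNormedType.Exports.
Local Open Scope classical_set_scope.
Local Open Scope ring_scope.

Section paths.
Context {d : measure_display} {T : measurableType d} {R : realType}.
Variable P : probability T R.
Local Notation mu := (@lebesgue_measure R).

(* As every A i may be setT, the product rule for the whole family gives it
   for every subfamily. *)
Definition mutually_independent n (Y : 'I_n -> T -> R) : Prop :=
  forall A : 'I_n -> set R, (forall i, measurable (A i)) ->
    P (\bigcap_(i in [set: 'I_n]) (Y i @^-1` A i)) =
    (\prod_(i < n) fine (P (Y i @^-1` A i)))%:E.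

(* Two-sided Wiener process with diffusion coefficient D; only its increments
   matter, so no value is prescribed at time 0.  The second argument of
   normal_prob is the standard deviation. *)
Record is_wiener (D : R) (xi : R -> {RV P >-> R}) : Prop := {
  wiener_gaussian : forall s t, s < t -> forall A : set R, measurable A ->
    P ((xi t \- xi s) @^-1` A) =
    normal_prob 0 (Num.sqrt (2 * D * (t - s))) A ;
  wiener_independent : forall n (t : nat -> R),
    (forall i, t i <= t i.+1) ->
    mutually_independent (fun i : 'I_n => xi (t i.+1) \- xi (t i)) ;
  wiener_continuous : {ae P, forall w, continuous (fun t => xi t w)} }.

(* f is a version of y |-> E[Z | Y = y]. *)
Record is_conditional_mean (Z Y : T -> R) (f : R -> R) : Prop := {
  cmean_measurable : measurable_fun [set: R] f ;
  cmean_integrable : P.-integrable [set: T] (EFin \o Z) ;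
  cmean_integrable_version : P.-integrable [set: T] (EFin \o (f \o Y)) ;
  cmean_eq : forall A : set R, measurable A ->
    (\int[P]_(w in Y @^-1` A) (Z w)%:E =
     \int[P]_(w in Y @^-1` A) (f (Y w))%:E)%E }.

(* In both definitions the average is taken over the paths that pass through
   the point x at time t. *)
Definition is_forward_mean_velocity (X : R -> {RV P >-> R}) (b : R -> R -> R)
    : Prop :=
  forall t, exists f : R -> R -> R,
    (forall h, 0 < h ->
       is_conditional_mean (fun w => (X (t + h) w - X t w) / h) (X t) (f h)) /\
    (forall x, f h x @[h --> 0^'+] --> b x t).

Definition is_backward_mean_velocity (X : R -> {RV P >-> R}) (b : R -> R -> R)
    : Prop :=
  forall t, exists f : R -> R -> R,
    (forall h, 0 < h ->
       is_conditional_mean (fun w => (X t w - X (t - h) w) / h) (X t) (f h)) /\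
    (forall x, f h x @[h --> 0^'+] --> b x t).

(* dX = b(X, t) dt + dxi.  The noise is additive, so the integrated equation
   only involves Lebesgue integrals along paths. *)
Definition driven_by (X : R -> {RV P >-> R}) (b : R -> R -> R)
    (xi : R -> {RV P >-> R}) : Prop :=
  {ae P, forall w, forall s t, s <= t ->
    mu.-integrable `[s, t] (fun r => (b (X r w) r)%:E) /\
    X t w - X s w =
      Rintegral mu `[s, t] (fun r => b (X r w) r) + (xi t w - xi s w)}.

(* dX = b_+ dt + dxi_+ for dt > 0 and dX = b_- dt + dxi_- for dt < 0.  Over an
   interval [s, t] the backward equation integrates to the same expression as
   the forward one, with b_- and xi_- for b_+ and xi_+, and the convention
   <dxi_-^2> = - 2 D dt for dt < 0 is the Wiener variance 2 D |dt|. *)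
Record fractal_motion (D : R) (X : R -> {RV P >-> R}) (bp bm : R -> R -> R)
    (xip xim : R -> {RV P >-> R}) : Prop := {
  motion_continuous : {ae P, forall w, continuous (fun t => X t w)} ;
  motion_forward_velocity : is_forward_mean_velocity X bp ;
  motion_backward_velocity : is_backward_mean_velocity X bm ;
  motion_forward_noise : is_wiener D xip ;
  motion_backward_noise : is_wiener D xim ;
  motion_forward : driven_by X bp xip ;
  motion_backward : driven_by X bm xim }.

Record is_density (Y : {RV P >-> R}) (r : R -> R) : Prop := {
  density_measurable : measurable_fun [set: R] r ;
  density_ge0 : forall x, 0 <= r x ;
  density_eq : forall A : set R, measurable A ->
    distribution P Y A = (\int[mu]_(x in A) (r x)%:E)%E }.

End paths.

Section quantum.
Context {R : realType}.
Variables (hbar m : R) (rho : R -> R -> R).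

Definition sqrt_density (x t : R) : R := Num.sqrt (rho x t).

Definition osmotic_velocity (x t : R) : R :=
  hbar / m * (derive1 (sqrt_density ^~ t) x / sqrt_density x t).

Definition quantum_potential (x t : R) : R :=
  - (hbar ^+ 2 / (2 * m)) * (derive1n 2 (sqrt_density ^~ t) x / sqrt_density x t).

End quantum.

(* Main.v *)
Require Import Defs.
From mathcomp Require Import all_boot all_order all_algebra.
From mathcomp Require Import all_classical all_reals all_analysis.
From mathcomp Require Import ring.
Import Order.TTheory GRing.Theory Num.Theory.
Import numFieldNormedType.Exports.
Local Open Scope classical_set_scope.
Local Open Scope ring_scope.

(* With u = sqrt rho, the osmotic velocity is a multiple of the logarithmic
   derivative v = u'/u, and the identity is the Riccati relation
   u''/u = v' + v^2. *)

(** Since U = (hbar/m) v, both -(m/2) U^2 and -(hbar/2) U' carry the factor -hbar^2/(2m), and the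
    Riccati relation turns their sum into Q. [derive1_logderiv] supplies that relation. Its
    regularity conditions on sqrt rho are inherited from those on rho, because the square root is
    smooth away from 0. *)

Lemma is_derive1_div (R : realType) (f g : R -> R) (x a b : R) :
  g x != 0 -> is_derive x 1 f a -> is_derive x 1 g b ->
  is_derive x 1 (fun y => f y / g y) ((a * g x - f x * b) / g x ^+ 2).
Proof.
move=> gx0 dfx dgx.
have dVx := is_deriveV gx0 dgx.
apply: (is_derive_eq (is_deriveM dfx dVx)); rewrite /GRing.scale /=.
by field.
Qed.

Lemma is_derive1_sqrt_comp (R : realType) (f : R -> R) (x : R) :
  0 < f x -> derivable f x 1 ->
  is_derive x 1 (fun y => Num.sqrt (f y)) (derive1 f x / (2 * Num.sqrt (f x))).
Proof.
move=> fx0 dfx; rewrite derive1E mulrC.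
exact: is_derive1_comp (is_derive1_sqrt fx0) (derivableP dfx).
Qed.

(** Positivity and differentiability are asked at every point, not just at [x], because the closed
    form f'/(2 sqrt f) has to replace [derive1] as a function before the quotient rule is applied at
    [x]. *)
Lemma derivable_derive1_sqrt (R : realType) (f : R -> R) (x : R) :
  (forall y, 0 < f y) -> (forall y, derivable f y 1) ->
  derivable (derive1 f) x 1 ->
  derivable (derive1 (fun y => Num.sqrt (f y))) x 1.
Proof.
move=> f0 df ddfx.
have -> : derive1 (fun y => Num.sqrt (f y)) =
          (fun y => derive1 f y / (2 * Num.sqrt (f y))).
  apply/funext => y.
  by rewrite derive1E (@derive_val _ _ _ _ _ _ _ (is_derive1_sqrt_comp _ _ _ (f0 y) (df y))).
have dg : is_derive x 1 (fun y => 2 * Num.sqrt (f y))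
    (2 * (derive1 f x / (2 * Num.sqrt (f x)))).
  exact: is_deriveZ (is_derive1_sqrt_comp _ _ _ (f0 x) (df x)).
have g0 : 2 * Num.sqrt (f x) != 0 by rewrite mulf_neq0// gt_eqF// sqrtr_gt0.
by have [] := is_derive1_div _ _ (fun y => 2 * Num.sqrt (f y)) _ _ _
  g0 (derivableP ddfx) dg.
Qed.

(** Quotient rule: (u'/u)' = (u'' u - u'^2)/u^2. The constant [c] stands for hbar/m. *)
Lemma derive1_logderiv (R : realType) (u : R -> R) (c x : R) :
  u x != 0 -> derivable u x 1 -> derivable (derive1 u) x 1 ->
  derive1 (fun y => c * (derive1 u y / u y)) x =
  c * (derive1n 2 u x / u x - (derive1 u x / u x) ^+ 2).
Proof.
move=> ux0 dux ddux.
have dv := is_derive1_div _ _ _ _ _ _ ux0 (derivableP ddux) (derivableP dux).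
rewrite derive1E (@derive_val _ _ _ _ _ _ _ (is_deriveZ c dv)) -!derive1E /GRing.scale /=.
by field.
Qed.

Theorem proposition1p1 (R : realType) (d : measure_display)
    (T : measurableType d) (P : probability T R) (hbar m : R)
    (X : R -> {RV P >-> R}) (bp bm : R -> R -> R)
    (xip xim : R -> {RV P >-> R}) (rho : R -> R -> R) :
  0 < m -> 0 < hbar ->
  fractal_motion (hbar / (2 * m)) X bp bm xip xim ->
  (forall t, is_density (X t) (rho ^~ t)) ->
  (forall x t : R, 0 < rho x t) ->
  (forall x t : R, derivable (rho ^~ t) x 1) ->
  (forall x t : R, derivable (derive1 (rho ^~ t)) x 1) ->
  forall x t,
    quantum_potential hbar m rho x t =
    - (m / 2) * osmotic_velocity hbar m rho x t ^+ 2
    - hbar / 2 * derive1 (osmotic_velocity hbar m rho ^~ t) x.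
Proof.
move=> m0 _ _ _ rho0 drho ddrho x t.
have u0 : sqrt_density rho x t != 0 by rewrite gt_eqF// sqrtr_gt0.
have du : derivable (sqrt_density rho ^~ t) x 1.
  by have [] := is_derive1_sqrt_comp _ _ _ (rho0 x t) (drho x t).
have ddu : derivable (derive1 (sqrt_density rho ^~ t)) x 1.
  exact: (derivable_derive1_sqrt _ (rho ^~ t)).
rewrite /quantum_potential /osmotic_velocity derive1_logderiv//.
have m_neq0 : m != 0 by rewrite gt_eqF.
(* The squares of v = u'/u cancel: -(m/2)(hbar/m)^2 v^2 + (hbar/2)(hbar/m) v^2 = 0, which leaves the
   u''/u term. *)
by field; rewrite u0 m_neq0.
Qed.
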